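(* Let $\nu^1={\stackrel{*}{\nu}}{}^1+\widetilde\nu{}^1i$ (${\stackrel{*}{\nu}}{}^1={\rm Re}\,\nu^1$, $\widetilde\nu{}^1={\rm Im}\,\nu^1$) be an eigenvector of the matrix $B$ corresponding to the complex eigenvalue $\lambda_1={\stackrel{*}{\lambda}}_1+\widetilde\lambda_1i$ (${\stackrel{*}{\lambda}}_1={\rm Re}\,\lambda_1$, $\widetilde\lambda_1={\rm Im}\,\lambda_1\ne0$), and let $\nu^2$ be a real eigenvector of $B$ corresponding to the eigenvalue $\lambda_2\neq0$. Then the system of ordinary differential equations $\dfrac{dx}{dt}=Ax$ has the autonomous first integral $$F\colon x\to\nu^2x\cdot\exp\Bigl(-\frac{\lambda_2}{\widetilde\lambda_1}\arctan\frac{\widetilde\nu{}^1x}{{\stackrel{*}{\nu}}{}^1x}\Bigr)\quad\text{for all }x\in\mathscr X,$$ where $\mathscr X\subset\{x\colon{\stackrel{*}{\nu}}{}^1x\ne0\}$ is a domain.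
   Context: $A$ is a real $n\times n$ matrix, $x\in\mathbb R^n$, and $B=A^T$. For a vector $\nu$, $\nu x=\sum_{i=1}^n\nu_ix_i$. A continuously differentiable function $F$ on a domain $\mathscr X\subset\mathbb R^n$ is an autonomous first integral of $dx/dt=Ax$ if $\sum_{i=1}^n(Ax)_i\,\partial_{x_i}F(x)=0$ on $\mathscr X$. *)

(* Defs.v *)
From HB Require Import structures.
From mathcomp Require Import all_boot all_order all_algebra.
From mathcomp Require Import all_classical all_reals all_analysis.
From mathcomp Require Import complex.

Set Implicit Arguments.
Unset Strict Implicit.
Unset Printing Implicit Defensive.

Import Order.TTheory GRing.Theory Num.Theory.
Import numFieldNormedType.Exports.

Local Open Scope classical_set_scope.
Local Open Scope ring_scope.

(* The eigenvectors behind mxalgebra's eigenspace and eigenvalue are row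
   vectors (v *m M = a *: v); here eigenvectors are columns. *)
Definition is_eigenvector (K : fieldType) (n : nat)
    (M : 'M[K]_n) (a : K) (v : 'cV[K]_n) : Prop :=
  v != 0 /\ M *m v = a *: v.

Definition complexify (R : rcfType) (m n : nat) (M : 'M[R]_(m, n)) :
    'M[complex R]_(m, n) := map_mx (real_complex R) M.

Definition Re_vec (R : rcfType) (n : nat) (v : 'cV[complex R]_n) :
    'cV[R]_n := map_mx (@complex.Re R) v.

Definition Im_vec (R : rcfType) (n : nat) (v : 'cV[complex R]_n) :
    'cV[R]_n := map_mx (@complex.Im R) v.

(* The bilinear pairing written nu x. *)
Definition pairing (R : pzRingType) (n : nat) (nu x : 'cV[R]_n) : R :=
  \sum_(i < n) nu i 0 * x i 0.

Definition is_domain (T : topologicalType) (X : set T) : Prop :=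
  [/\ X !=set0, open X & connected X].

Definition partial (R : realType) (n : nat) (F : 'cV[R]_n -> R) (i : 'I_n) :
    'cV[R]_n -> R := 'D_(delta_mx i 0) F.

(* Meant for open X: both clauses use full neighbourhoods of x. *)
Definition continuously_differentiable_on (R : realType) (n : nat)
    (X : set 'cV[R]_n) (F : 'cV[R]_n -> R) : Prop :=
  (forall x, X x -> differentiable F x) /\
  (forall i x, X x -> {for x, continuous (partial F i)}).

Definition autonomous_first_integral (R : realType) (n : nat) (A : 'M[R]_n)
    (X : set 'cV[R]_n) (F : 'cV[R]_n -> R) : Prop :=
  continuously_differentiable_on X F /\
  (forall x, X x -> \sum_(i < n) (A *m x) i 0 * partial F i x = 0).

(* Main.v *)
Require Import Defs.
From HB Require Import structures.
From mathcomp Require Import all_boot all_order all_algebra.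
From mathcomp Require Import all_classical all_reals all_analysis.
From mathcomp Require Import complex.
From mathcomp Require Import ring.

Set Implicit Arguments.
Unset Strict Implicit.
Unset Printing Implicit Defensive.

Import Order.TTheory GRing.Theory Num.Theory.
Import numFieldNormedType.Exports.

Local Open Scope classical_set_scope.
Local Open Scope ring_scope.

(** Write [u] and [v] for the real and imaginary parts of the complex
eigenvector [nu1], and [lambda1 = a + b i].  Pairing with [A x] is pairing with
[x] after applying the transpose of [A], so along the flow of [A] the linear
forms given by the eigenvectors satisfy a closed system:
  [(u x)' = a (u x) - b (v x)], [(v x)' = b (u x) + a (v x)],
  [(nu2 x)' = lambda2 (nu2 x)]
(lemmas [pairing_Re_Im_eigenvector] and [pairing_eigenvector]).  The point
[(u x, v x)] of the plane therefore turns around the origin, and its polar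
angle [atan (v x / u x)] grows at the constant rate
  [((v x)' (u x) - (v x) (u x)') / ((u x)^2 + (v x)^2) = b].
Hence [exp (- (lambda2 / b) angle)] decays at rate [lambda2], which cancels the
growth of [nu2 x]; their product is constant along the flow.

In terms of differentials, the sum of the [(A x)_i] times the partial
derivatives of [F] is the differential of [F] at [x] in the direction [A x]
([sum_partial]), and this differential has an explicit form
([is_diff_mul_exp_angle]).  The same formula, evaluated on the basis vectors at
all points near [x], shows that the partial derivatives are continuous
([continuous_partial_mul_exp_angle]). *)

(** * The pairing and the eigenvector equations *)

Lemma pairing_is_linear (R : comPzRingType) (n : nat) (nu : 'cV[R]_n) :
  linear (pairing nu : 'cV[R]_n -> R^o).
Proof.
move=> a x y; rewrite /pairing scaler_sumr -big_split; apply: eq_bigr => i _ /=.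
by rewrite !mxE mulrDr; congr (_ + _); rewrite mulrCA.
Qed.

Lemma pairing_delta (R : pzRingType) (n : nat) (nu : 'cV[R]_n) (i : 'I_n) :
  pairing nu (delta_mx i 0) = nu i 0.
Proof.
rewrite /pairing (bigD1 i) //= big1 ?addr0 ?mxE ?eqxx ?mulr1 // => j ji.
by rewrite mxE (negPf ji) mulr0.
Qed.

Lemma pairing_mulmx (R : comPzRingType) (n : nat) (A : 'M[R]_n)
    (nu x : 'cV[R]_n) : pairing nu (A *m x) = pairing (A^T *m nu) x.
Proof.
have pairingE (mu y : 'cV[R]_n) : pairing mu y = (mu^T *m y) 0 0.
  by rewrite mxE; apply: eq_bigr => i _; rewrite mxE.
by rewrite !pairingE trmx_mul trmxK mulmxA.
Qed.

Lemma pairing_eigenvector (R : fieldType) (n : nat) (A : 'M[R]_n) (a : R)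
    (nu x : 'cV[R]_n) :
  is_eigenvector A^T a nu -> pairing nu (A *m x) = a * pairing nu x.
Proof.
move=> [_ Anu]; rewrite pairing_mulmx Anu /pairing mulr_sumr.
by apply: eq_bigr => i _; rewrite mxE mulrA.
Qed.

(** Since [A] is real, these are the real and imaginary parts of the single
complex equation [nu (A x) = l (nu x)]. *)
Lemma pairing_Re_Im_eigenvector (R : rcfType) (n : nat) (A : 'M[R]_n)
    (l : complex R) (nu : 'cV[complex R]_n) (x : 'cV[R]_n) :
  is_eigenvector (complexify A^T) l nu ->
  pairing (Re_vec nu) (A *m x) =
    complex.Re l * pairing (Re_vec nu) x - complex.Im l * pairing (Im_vec nu) x
  /\ pairing (Im_vec nu) (A *m x) =
    complex.Im l * pairing (Re_vec nu) x + complex.Re l * pairing (Im_vec nu) x.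
Proof.
move=> [_ Anu]; rewrite !pairing_mulmx.
have AnuE i : \sum_j complexify A^T i j * nu j 0 = l * nu i 0.
  by have := congr1 (fun M : 'cV_n => M i 0) Anu; rewrite !mxE.
split.
- have -> : A^T *m Re_vec nu =
      complex.Re l *: Re_vec nu - complex.Im l *: Im_vec nu.
    apply/colP => i; rewrite !mxE.
    have := congr1 (@complex.Re R) (AnuE i); rewrite raddf_sum /=.
    have -> : complex.Re (l * nu i 0) = complex.Re l * complex.Re (nu i 0)
        - complex.Im l * complex.Im (nu i 0).
      by case: l {Anu AnuE} => a b; case: (nu i 0).
    move=> <-; apply: eq_bigr => j _; rewrite !mxE.
    by case: (nu j 0) => a b /=; rewrite mul0r subr0.
  rewrite /pairing !mulr_sumr -sumrB.
  by apply: eq_bigr => i _; rewrite !mxE mulrBl !mulrA.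
- have -> : A^T *m Im_vec nu =
      complex.Im l *: Re_vec nu + complex.Re l *: Im_vec nu.
    apply/colP => i; rewrite !mxE.
    have := congr1 (@complex.Im R) (AnuE i); rewrite raddf_sum /=.
    have -> : complex.Im (l * nu i 0) = complex.Im l * complex.Re (nu i 0)
        + complex.Re l * complex.Im (nu i 0).
      by case: l {Anu AnuE} => a b; case: (nu i 0) => c d /=; rewrite addrC.
    move=> <-; apply: eq_bigr => j _; rewrite !mxE.
    by case: (nu j 0) => a b /=; rewrite mul0r addr0.
  rewrite /pairing !mulr_sumr -big_split.
  by apply: eq_bigr => i _; rewrite !mxE mulrDl !mulrA.
Qed.

(** * Differential of a linear form times the exponential of an angle *)

Lemma sqr_add_neq0 (R : realDomainType) (a b : R) :
  a != 0 -> a ^+ 2 + b ^+ 2 != 0.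
Proof. by move=> a0; rewrite gt_eqF // ltr_wpDr ?sqr_ge0 // exprn_even_gt0. Qed.

Section Differentials.
Variable R : realType.

Let scaleRE (a b : R) : a *: b = a * b. Proof. by []. Qed.

(** The chain rule for an outer function known only through its derivative in
one variable, as is the case for [expR], [atan] and the inverse. *)
Lemma is_diff_comp_derive (V : normedModType R) (f df : V -> R) (g : R -> R)
    (dg : R) (x : V) :
  is_diff x f df -> is_derive (f x) (1 : R) g dg ->
  is_diff x (g \o f) (fun h => dg * df h).
Proof.
move=> dfx dgx.
have dgP : differentiable g (f x) by apply/derivable1_diffP.
have dgd : is_diff (f x) g ( *:%R^~ dg).
  by apply: DiffDef => //; rewrite diff1E // derive1E derive_val.
have := is_diff_comp dfx dgd.
by move/is_diff_eq; apply; apply/funext => h /=; rewrite mulrC.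
Qed.

Lemma is_diff_pairing (n : nat) (nu x : 'cV[R]_n) :
  is_diff x (pairing nu) (pairing nu).
Proof.
pose lin := GRing.isLinear.Build _ _ _ _ _ (pairing_is_linear nu).
pose P : {linear 'cV[R]_n -> R^o} := HB.pack (pairing nu : 'cV[R]_n -> R^o) lin.
have cP : continuous P.
  move=> y; apply: differentiable_continuous.
  have -> : (P : 'cV[R]_n -> R) =
      \sum_(i < n) (fun z : 'cV[R]_n => nu i 0 *: (z i 0 : R)).
    by apply/funext => z; rewrite fct_sumE.
  apply: differentiable_sum => i.
  by apply: differentiableZ; exact: differentiable_coord.
apply: DiffDef; first exact: (@linear_differentiable _ _ _ P).
exact: (@diff_lin _ _ _ P).
Qed.

Lemma continuous_pairing (n : nat) (nu : 'cV[R]_n) : continuous (pairing nu).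
Proof.
move=> x; apply: differentiable_continuous.
exact: (@ex_diff _ _ _ _ _ _ _ (is_diff_pairing nu x)).
Qed.

Lemma partial_is_diff (n : nat) (F dF : 'cV[R]_n -> R) (x : 'cV[R]_n)
    (i : 'I_n) : is_diff x F dF -> partial F i x = dF (delta_mx i 0).
Proof. by move=> dFx; rewrite /partial deriveE // diff_val. Qed.

(** By linearity of the differential: a vector field applied to [F] through
partial derivatives is the differential in the direction of the field. *)
Lemma sum_partial (n : nat) (F dF : 'cV[R]_n -> R) (x h : 'cV[R]_n) :
  is_diff x F dF -> \sum_(i < n) h i 0 * partial F i x = dF h.
Proof.
move=> dFx; rewrite -[dF]diff_val {2}(matrix_sum_delta h) linear_sum.
apply: eq_bigr => i _.
by rewrite big_ord1 linearZ (partial_is_diff i dFx) -[dF]diff_val.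
Qed.

(** Up to a locally constant multiple of pi, the function is the polar angle of
the point [(u y, v y)], and its differential is the usual angular form
[(p dq - q dp) / (p^2 + q^2)] pulled back to ['cV_n]. *)
Lemma is_diff_angle (n : nat) (u v x : 'cV[R]_n) : pairing u x != 0 ->
  is_diff x (fun y => atan (pairing v y / pairing u y))
    (fun h => (pairing v h * pairing u x - pairing v x * pairing u h) /
              (pairing u x ^+ 2 + pairing v x ^+ 2)).
Proof.
move=> ux0.
have dV : is_derive (pairing u x) (1 : R) (@GRing.inv R) (- pairing u x ^- 2).
  have := is_deriveV (f := id) (x := pairing u x) ux0 (is_derive_id _ (1 : R)).
  by rewrite scaleRE mulr1.
have dinv := is_diff_comp_derive (is_diff_pairing u x) dV.
have dquo := is_diffM (is_diff_pairing v x) dinv.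
have := is_diff_comp_derive dquo (is_derive1_atan _).
move/is_diff_eq; apply; apply/funext => h /=.
rewrite !fctE /= ?scaleRE.
have sq := sqr_add_neq0 (pairing v x) ux0.
move: sq ux0; move: (pairing u x) (pairing v x) (pairing u h) (pairing v h).
by move=> a b c d sq a0; field; rewrite sq.
Qed.

Lemma is_diff_mul_exp_angle (n : nat) (w u v x : 'cV[R]_n) (c : R) :
  pairing u x != 0 ->
  is_diff x
    (fun y => pairing w y * expR (- c * atan (pairing v y / pairing u y)))
    (fun h => expR (- c * atan (pairing v x / pairing u x)) *
      (pairing w h - c * pairing w x *
         ((pairing v h * pairing u x - pairing v x * pairing u h) /
          (pairing u x ^+ 2 + pairing v x ^+ 2)))).
Proof.
move=> ux0.
have dexp := is_diff_comp_derive (is_diffZ (- c) (is_diff_angle v ux0))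
  (is_derive_expR _).
have := is_diffM (is_diff_pairing w x) dexp.
move/is_diff_eq; apply; apply/funext => h /=.
rewrite !fctE /= ?scaleRE.
ring.
Qed.

(** The differential gives a closed formula for the partial derivative wherever
[u y] is nonzero.  This is an open condition, so the formula holds on a whole
neighbourhood of [x], and continuity is read off from it. *)
Lemma continuous_partial_mul_exp_angle (n : nat) (w u v x : 'cV[R]_n) (c : R)
    (i : 'I_n) : pairing u x != 0 ->
  {for x, continuous (partial
    (fun y => pairing w y * expR (- c * atan (pairing v y / pairing u y))) i)}.
Proof.
move=> ux0.
pose G y := expR (- c * atan (pairing v y / pairing u y)) *
  (w i 0 - c * pairing w y *
     ((v i 0 * pairing u y - pairing v y * u i 0) /
      (pairing u y ^+ 2 + pairing v y ^+ 2))).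
set P := partial _ i.
have PG y : pairing u y != 0 -> P y = G y.
  move=> uy0; have dF := is_diff_mul_exp_angle w v c uy0.
  by rewrite /P (partial_is_diff i dF) !pairing_delta.
have nearPG : {near x, G =1 P}.
  apply: filterS (cvgr_neq0 _ (@continuous_pairing n u x) ux0) => y uy0.
  by rewrite PG.
(* For an abstract filter, so that the limit rules apply to [F] itself and not
   to the entrywise description of neighbourhoods of a matrix. *)
have Gcvg (F : set_system 'cV[R]_n) : Filter F ->
    pairing w y @[y --> F] --> pairing w x ->
    pairing u y @[y --> F] --> pairing u x ->
    pairing v y @[y --> F] --> pairing v x ->
    G y @[y --> F] --> G x.
  move=> FF cw cu cv.
  apply: cvgM.
    apply: continuous_cvg; first exact: continuous_expR.
    apply: cvgM; first exact: cvg_cst.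
    apply: continuous_cvg; first exact: continuous_atan.
    by apply: cvgM => //; exact: cvgV.
  apply: cvgB; first exact: cvg_cst.
  apply: cvgM; first by apply: cvgM => //; exact: cvg_cst.
  apply: cvgM.
    by apply: cvgB; apply: cvgM => //; exact: cvg_cst.
  have sq := sqr_add_neq0 (pairing v x) ux0.
  by apply: cvgV => //; apply: cvgD; rewrite expr2; exact: cvgM.
have Gcont : G y @[y --> x] --> G x.
  exact: (Gcvg (nbhs x) (nbhs_filter x) (@continuous_pairing _ _ _)
    (@continuous_pairing _ _ _) (@continuous_pairing _ _ _)).
suff: P y @[y --> x] --> P x by [].
rewrite (PG x ux0).
exact: cvg_trans (near_eq_cvg nearPG) Gcont.
Qed.

End Differentials.

Theorem theorem3p4 (R : realType) (n : nat) (A : 'M[R]_n)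
    (nu1 : 'cV[complex R]_n) (lambda1 : complex R)
    (nu2 : 'cV[R]_n) (lambda2 : R) (X : set 'cV[R]_n)
    (hnu1 : is_eigenvector (complexify A^T) lambda1 nu1)
    (hlambda1 : complex.Im lambda1 != 0)
    (hnu2 : is_eigenvector A^T lambda2 nu2)
    (hlambda2 : lambda2 != 0)
    (hX : is_domain X)
    (hsub : X `<=` [set x | pairing (Re_vec nu1) x != 0]) :
  autonomous_first_integral A X (fun x : 'cV[R]_n =>
    pairing nu2 x *
    expR (- (lambda2 / complex.Im lambda1) *
          atan (pairing (Im_vec nu1) x / pairing (Re_vec nu1) x))).
Proof.
have dF x (Xx : X x) := is_diff_mul_exp_angle nu2 (Im_vec nu1)
  (lambda2 / complex.Im lambda1) (hsub x Xx).
split; first split.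
- by move=> x Xx; exact: (@ex_diff _ _ _ _ _ _ _ (dF x Xx)).
- by move=> i x Xx; apply: continuous_partial_mul_exp_angle; exact: hsub.
- move=> x Xx; rewrite (sum_partial _ (dF x Xx)).
  have [-> ->] := pairing_Re_Im_eigenvector x hnu1.
  rewrite (pairing_eigenvector x hnu2).
  have ux0 : pairing (Re_vec nu1) x != 0 := hsub x Xx.
  have sq := sqr_add_neq0 (pairing (Im_vec nu1) x) ux0.
  (* The angular form takes the value [Im lambda1] in the direction [A x]. *)
  by field; rewrite sq hlambda1.
Qed.
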